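(* Let $k\in\mathbb{N}$, $(x_1,\ldots,x_k)\in\mathbb{N}^k$ and $b\in\mathbb{N}$, and let $q_\ell$ denote the number of solutions $(a_1,\ldots,a_k)\in\mathbb{N}_0^k$ of the Diophantine equation $$x_1a_1+\cdots+x_ka_k-b\max_{1\le j\le k}a_j=\ell.$$ Then $$f_{k,b}^{(x_i)}(t):=\sum_{\ell=0}^{\infty}q_\ell t^\ell=\sum_{m=0}^{\infty}t^{-bm}\left(\prod_{j=1}^{k}\frac{1-t^{(m+1)x_j}}{1-t^{x_j}}-\prod_{j=1}^{k}\frac{1-t^{mx_j}}{1-t^{x_j}}\right),\qquad |t|<1.$$ In particular, the generating function $f_{k,b}^{(x_i)}$ is rational.
   Context: $\mathbb{N}=\{1,2,3,\ldots\}$ and $\mathbb{N}_0=\mathbb{N}\cup\{0\}$.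
   Formalization: The identity is proved only when b < x_j for all j: otherwise the right-hand series diverges for 0<|t|<1 (and q_0 may be infinite, e.g. k=1, x_1=b=1). Rationality is proved whenever all q_ℓ are finite. At t=0 the terms with m≥1 are read as 0. *)

(* Defs.v *)
From HB Require Import structures.
From mathcomp Require Import all_boot all_order all_algebra.
From mathcomp Require Import finmap.
From mathcomp Require Import all_classical all_reals all_analysis.
From mathcomp Require Import complex.
Set Implicit Arguments.
Unset Strict Implicit.
Unset Printing Implicit Defensive.
Import Order.TTheory GRing.Theory Num.Theory numFieldNormedType.Exports.
Local Open Scope classical_set_scope.
Local Open Scope ring_scope.
Local Open Scope complex_scope.

(* The left-hand side of the equation is an integer, possibly negative, so the
   subtraction takes place in int.  For k = 0 the maximum would be 0. *)
Definition solutions (k : nat) (x : 'I_k -> nat) (b l : nat) :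
    set {ffun 'I_k -> nat} :=
  [set a : {ffun 'I_k -> nat} |
    (\sum_(j < k) x j * a j)%N%:Z - (b * \max_(j < k) a j)%N%:Z = l%:Z].

(* fset_set A is the empty finite set when A is infinite, so this is the number
   of solutions only if solutions x b l is finite. *)
Definition num_solutions (k : nat) (x : 'I_k -> nat) (b l : nat) : nat :=
  #|` fset_set (solutions x b l)|%fset.

(* R[i]^o is R[i] with the topology of its norm `|z|. *)
Definition gen_term (R : realType) (k : nat) (x : 'I_k -> nat) (b : nat)
    (t : R[i]) : nat -> R[i]^o :=
  fun l => (num_solutions x b l)%:R * t ^+ l.

Definition gen_fun (R : realType) (k : nat) (x : 'I_k -> nat) (b : nat)
    (t : R[i]) : R[i]^o :=
  limn (series (gen_term x b t)).

(* Since 0^-1 = 0, at t = 0 this is 0 for m > 0.  That is the value of the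
   continuous extension when b < x j for all j: the parenthesis is then a
   polynomial in t divisible by t ^+ (b.+1 * m). *)
Definition product_term (R : realType) (k : nat) (x : 'I_k -> nat) (b : nat)
    (t : R[i]) : nat -> R[i]^o :=
  fun m => t ^- (b * m) *
    (\prod_(j < k) ((1 - t ^+ (m.+1 * x j)) / (1 - t ^+ x j))
     - \prod_(j < k) ((1 - t ^+ (m * x j)) / (1 - t ^+ x j))).

Definition rational_on_unit_disc (R : realType) (f : R[i] -> R[i]) : Prop :=
  exists p q : {poly R[i]}, forall t : R[i], `|t| < 1 ->
    q.[t] != 0 /\ f t = p.[t] / q.[t].

(* Main.v *)
Require Import Defs.
From HB Require Import structures.
From mathcomp Require Import all_boot all_order all_algebra.
From mathcomp Require Import finmap.
From mathcomp Require Import all_classical all_reals all_analysis.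
From mathcomp Require Import complex.
Import Order.TTheory GRing.Theory Num.Theory numFieldNormedType.Exports.
Local Open Scope classical_set_scope.
Local Open Scope ring_scope.
Local Open Scope complex_scope.
Set Implicit Arguments.
Unset Strict Implicit.
Unset Printing Implicit Defensive.

(** Put F(a) = x.a - b max a.  If b < x_j for all j, then F(a) >= a_1 + ... + a_k.
    The m-th product term is the sum of t^F(a) over the a with max a = m, so the
    N-th partial sums of the two series both run over the a in [0,N)^k, the left
    one restricted to F(a) < N.  With s^2 = |t|, |t|^F(a) <= s^N s^(a_1+...+a_k)
    for the remaining a, so the difference is at most s^N (1 - s)^-k, which tends
    to 0.  Expanding the products over the subsets J of the indices turns the
    product series into finitely many geometric series of ratios t^(x_J - b),
    where x_J is the sum of the x_j over J; this gives both convergence and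
    rationality.

    For general b, if x_j <= b <= x_1 + ... + x_k for some j, then F vanishes on
    a whole ray, so q_0 is infinite.  Hence either b < x_j for all j, or
    x_1 + ... + x_k < b, in which case a = 0 is the only solution and f = 1. *)

(* Truncated subtraction: this is the left-hand side of the equation only where
   that is nonnegative, as it is when b < x j for all j. *)
Definition excess (k : nat) (x : 'I_k -> nat) (b : nat) (a : 'I_k -> nat) : nat :=
  (\sum_(j < k) x j * a j - b * \max_(j < k) a j)%N.

Lemma bigmax_leq_sum (I : finType) (F : I -> nat) :
  (\max_i F i <= \sum_i F i)%N.
Proof. by apply/bigmax_leqP => i _; rewrite (bigD1 i) //= leq_addr.
Qed.

Lemma one_sub_exp_neq0 (F : numDomainType) (t : F) (n : nat) :
  (0 < n)%N -> `|t| < 1 -> 1 - t ^+ n != 0.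
Proof.
move=> n0 t1; rewrite subr_eq0 eq_sym; apply/eqP => /(congr1 Num.norm).
rewrite normrX normr1 => tn.
by have := exprn_ilt1 n (normr_ge0 t) t1; rewrite tn ltxx gtn_eqF.
Qed.

Section LargeCoefficients.
Context (k : nat) (x : 'I_k -> nat) (b : nat).
Hypothesis b_lt_x : forall j, (b < x j)%N.

Lemma sum_mul_ge (a : 'I_k -> nat) :
  (b * \max_(j < k) a j + \sum_(j < k) a j <= \sum_(j < k) x j * a j)%N.
Proof.
apply: (@leq_trans (\sum_(j < k) b.+1 * a j)%N); last first.
  by apply: leq_sum => j _; rewrite leq_mul2r b_lt_x orbT.
by rewrite -big_distrr /= mulSn addnC leq_add2l leq_mul2l bigmax_leq_sum orbT.
Qed.

Lemma sum_leq_excess (a : 'I_k -> nat) : (\sum_(j < k) a j <= excess x b a)%N.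
Proof.
by rewrite /excess leq_subRL ?sum_mul_ge// (leq_trans _ (sum_mul_ge a))// leq_addr.
Qed.

Lemma excessE (a : 'I_k -> nat) :
  (\sum_(j < k) x j * a j = b * \max_(j < k) a j + excess x b a)%N.
Proof.
by rewrite /excess subnKC// (leq_trans _ (sum_mul_ge a))// leq_addr.
Qed.

Lemma solutionsE (l : nat) (a : {ffun 'I_k -> nat}) :
  solutions x b l a <-> excess x b a = l.
Proof.
rewrite /solutions /= excessE PoszD addrAC subrr add0r.
by split=> [[]|->].
Qed.

Definition nat_ffun (N : nat) (f : {ffun 'I_k -> 'I_N}) : {ffun 'I_k -> nat} :=
  [ffun j => f j : nat].

Lemma nat_ffun_inj (N : nat) : injective (@nat_ffun N).
Proof.
move=> f g /ffunP fg; apply/ffunP => j; apply: val_inj.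
by have := fg j; rewrite !ffunE.
Qed.

Lemma excess_nat_ffun (N : nat) (f : {ffun 'I_k -> 'I_N}) :
  excess x b (nat_ffun f) = excess x b (fun j => f j).
Proof.
rewrite /excess; by congr (_ - _ * _)%N; apply: eq_bigr => j _; rewrite ffunE.
Qed.

Lemma solutions_image (N l : nat) : (l < N)%N ->
  solutions x b l =
  [set nat_ffun f | f in
    [set f : {ffun 'I_k -> 'I_N} | excess x b (fun j => f j) == l]].
Proof.
move=> lN; apply/seteqP; split=> a.
  move=> /solutionsE al.
  have aN j : (a j < N)%N.
    apply: leq_ltn_trans lN; rewrite -al.
    by apply: leq_trans (sum_leq_excess a); rewrite (bigD1 j) //= leq_addr.
  exists [ffun j => Ordinal (aN j)].
    rewrite /= -excess_nat_ffun -al; apply/eqP; congr excess.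
    by apply/funext => j; rewrite !ffunE.
  by apply/ffunP => j; rewrite !ffunE.
by case=> f /= /eqP fl <-; apply/solutionsE; rewrite excess_nat_ffun.
Qed.

Lemma finite_solutions (l : nat) : finite_set (solutions x b l).
Proof.
rewrite (@solutions_image l.+1)//; apply: finite_image; exact: finite_finset.
Qed.

Lemma num_solutionsE (N l : nat) : (l < N)%N ->
  num_solutions x b l =
  #|[pred f : {ffun 'I_k -> 'I_N} | excess x b (fun j => f j) == l]|.
Proof.
move=> lN; rewrite /num_solutions.
rewrite (_ : fset_set _ = [fset nat_ffun f | f in
  [pred f : {ffun 'I_k -> 'I_N} | excess x b (fun j => f j) == l]]%fset).
  by rewrite card_imfset ?cardE//=; exact: nat_ffun_inj.
apply/fsetP => a; rewrite in_fset_set; last exact: finite_solutions.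
apply/idP/imfsetP => [|[f /= fl ->]]; rewrite inE (solutions_image lN).
  by case=> f fl <-; exists f.
by exists f.
Qed.

Lemma sum_num_solutions (R : pzRingType) (t : R) (N : nat) :
  \sum_(l < N) (num_solutions x b l)%:R * t ^+ l =
  \sum_(f : {ffun 'I_k -> 'I_N} | (excess x b (fun j => f j) < N)%N)
     t ^+ excess x b (fun j => f j).
Proof.
case: N => [|N]; first by rewrite big_ord0 big_pred0.
rewrite (partition_big (fun f : {ffun 'I_k -> 'I_N.+1} =>
  inord (excess x b (fun j => f j)) : 'I_N.+1) xpredT)//=.
apply: eq_bigr => l _; rewrite (num_solutionsE (ltn_ord l)).
rewrite -sum1_card natr_sum mulr_suml; apply: eq_big => f /=.
  rewrite inE; apply/eqP/andP => [fl|[fl /eqP <-]]; last by rewrite inordK.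
  by rewrite fl ltn_ord inord_val.
by rewrite inE => /eqP ->; rewrite mul1r.
Qed.

Lemma sum_bounded_max (R : comPzRingType) (t : R) (m N : nat) : (m <= N)%N ->
  \sum_(f : {ffun 'I_k -> 'I_N} | [forall j, (f j < m)%N])
      t ^+ (\sum_(j < k) x j * f j) =
  \prod_(j < k) \sum_(i < m) t ^+ (x j * i).
Proof.
move=> mN.
under [RHS]eq_bigr do rewrite (big_ord_widen _ (fun i => t ^+ (_ * i)) mN).
rewrite bigA_distr_big /=; apply: eq_big => f; last by rewrite expr_sum.
by apply/forallP/ffun_onP.
Qed.

Lemma forall_ltnS_max (a : 'I_k -> nat) (m : nat) : (0 < k)%N ->
  [forall j, (a j < m.+1)%N] && ~~ [forall j, (a j < m)%N] =
  (\max_(j < k) a j == m).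
Proof.
move=> k0; rewrite eqn_leq; congr (_ && _); first by
  apply/forallP/bigmax_leqP => [h j _|h j]; exact: h.
case: m => [|m].
  by apply/negP => /forallP /(_ (Ordinal k0)).
rewrite ltnNge; congr negb; apply/forallP/bigmax_leqP => [h j _|h j]; exact: h.
Qed.

(* At t = 0, where 0^-1 = 0, both sides are 0 unless a = 0. *)
Lemma exprN_mul_max (F : fieldType) (t : F) (a : 'I_k -> nat) :
  t ^- (b * \max_(j < k) a j) * t ^+ (\sum_(j < k) x j * a j) =
  t ^+ excess x b a.
Proof.
have [->|t0] := eqVneq t 0; last by rewrite excessE exprD mulKf// expf_neq0.
have [m0|m_gt0] := posnP (\max_(j < k) a j).
  by rewrite excessE m0 muln0 expr0 invr1 mul1r.
have sum_gt0 : (0 < \sum_(j < k) a j)%N := leq_trans m_gt0 (bigmax_leq_sum _).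
have e_gt0 := leq_trans sum_gt0 (sum_leq_excess a).
have expr0 n : (0 < n)%N -> (0 : F) ^+ n = 0 by case: n => // n; rewrite expr0n.
rewrite (expr0 _ e_gt0) (expr0 (\sum_(j < k) _)%N) ?mulr0// excessE.
by rewrite addn_gt0 e_gt0 orbT.
Qed.

Lemma prod_geometric_sum (F : numFieldType) (t : F) (m : nat) : `|t| < 1 ->
  \prod_(j < k) ((1 - t ^+ (m * x j)) / (1 - t ^+ x j)) =
  \prod_(j < k) \sum_(i < m) t ^+ (x j * i).
Proof.
move=> t1; apply: eq_bigr => j _.
have xj_gt0 : (0 < x j)%N by exact: leq_ltn_trans (b_lt_x j).
have tx := one_sub_exp_neq0 xj_gt0 t1.
under [RHS]eq_bigr do rewrite exprM.
by apply: (mulIf tx); rewrite divfK// mulnC exprM -[LHS]opprB subrX1 -mulNr opprB mulrC.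
Qed.

Section ProductSeries.
Context (R : realType) (t : R[i]).
Hypotheses (k_gt0 : (0 < k)%N) (t_lt1 : `|t| < 1).

Lemma product_termE (m N : nat) : (m < N)%N ->
  product_term x b t m =
  \sum_(f : {ffun 'I_k -> 'I_N} | \max_(j < k) f j == m)
     t ^+ excess x b (fun j => f j).
Proof.
move=> mN; rewrite /product_term !prod_geometric_sum//.
rewrite -(sum_bounded_max t mN) -(sum_bounded_max t (ltnW mN)).
rewrite (bigID (fun f : {ffun 'I_k -> 'I_N} => [forall j, (f j < m)%N])) /=.
rewrite [X in X + _ - _](eq_bigl
  (fun f : {ffun 'I_k -> 'I_N} => [forall j, (f j < m)%N])).
  rewrite addrAC subrr add0r mulr_sumr; apply: eq_big => f.
    exact: (forall_ltnS_max (fun j => f j)).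
  rewrite (forall_ltnS_max (fun j => f j))// => /eqP <-.
  exact: exprN_mul_max.
move=> f; apply/andP/idP => [[]//|/forallP fm]; split; apply/forallP => // j.
exact: ltnW (fm j).
Qed.

Lemma sum_product_term (N : nat) :
  \sum_(m < N) product_term x b t m =
  \sum_(f : {ffun 'I_k -> 'I_N}) t ^+ excess x b (fun j => f j).
Proof.
case: N => [|N].
  by rewrite big_ord0 big_pred0// => f; case: (f (Ordinal k_gt0)).
rewrite (partition_big (fun f : {ffun 'I_k -> 'I_N.+1} =>
  inord (\max_(j < k) f j) : 'I_N.+1) xpredT)//=.
apply: eq_bigr => m _; rewrite (product_termE (ltn_ord m)).
apply: eq_bigl => f; rewrite -val_eqE /= inordK// ltnS.
by apply/bigmax_leqP => j _; rewrite -ltnS.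
Qed.

Lemma sum_product_sub_gen_term (N : nat) :
  \sum_(m < N) product_term x b t m - \sum_(l < N) gen_term x b t l =
  \sum_(f : {ffun 'I_k -> 'I_N} | (N <= excess x b (fun j => f j))%N)
    t ^+ excess x b (fun j => f j).
Proof.
rewrite sum_product_term /gen_term sum_num_solutions.
rewrite (bigID (fun f : {ffun 'I_k -> 'I_N} => (excess x b (fun j => f j) < N)%N)) /=.
by rewrite addrAC subrr add0r; apply: eq_bigl => f; rewrite -leqNgt.
Qed.

End ProductSeries.

Lemma sum_large_excess_bound (F : numFieldType) (t s : F) (N : nat) :
  0 <= s -> s < 1 -> `|t| = s ^+ 2 ->
  `|\sum_(f : {ffun 'I_k -> 'I_N} | (N <= excess x b (fun j => f j))%N)
     t ^+ excess x b (fun j => f j)| <= s ^+ N * (1 - s)^-1 ^+ k.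
Proof.
move=> s0 s1 ts; apply: (le_trans (ler_norm_sum _ _ _)).
apply: (@le_trans _ _ (\sum_(f : {ffun 'I_k -> 'I_N}) s ^+ N * \prod_(j < k) s ^+ f j)).
  rewrite big_mkcond /=; apply: ler_sum => f _; case: ifP => [Nf|_]; last first.
    by rewrite mulr_ge0 ?exprn_ge0// prodr_ge0// => j _; rewrite exprn_ge0.
  rewrite normrX ts -exprM mul2n -addnn exprD -expr_sum.
  rewrite ler_pM ?exprn_ge0// ?ler_wiXn2l// ?(ltW s1)//.
  exact: sum_leq_excess.
rewrite -mulr_sumr ler_wpM2l ?exprn_ge0//.
rewrite -(bigA_distr_bigA (fun _ (i : 'I_N) => s ^+ i)).
rewrite prodr_const card_ord lerXn2r ?nnegrE ?invr_ge0 ?subr_ge0 ?(ltW s1)//.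
  by apply: sumr_ge0 => i _; rewrite exprn_ge0.
rewrite -[leRHS]mul1r ler_pdivlMr ?subr_gt0// mulrC -opprB mulNr -subrX1 opprB.
by rewrite lerBlDr lerDl exprn_ge0.
Qed.

End LargeCoefficients.

Section Convergence.
Context (R : realType).

Lemma cvg_exprC (z : R[i]) : `|z| < 1 ->
  ((fun n => z ^+ n) : nat -> R[i]^o) @ \oo --> (0 : R[i]^o).
Proof.
rewrite normc_def; set r := Num.sqrt _ => r1.
have r01 : `|r| < 1 by rewrite ger0_norm ?sqrtr_ge0// -ltcR.
apply/cvgr0Pnorm_lt => e; rewrite ltcE => /andP[/eqP e_im e_re].
have := cvg_geometric 1 r01 => /cvgr0Pnorm_lt /(_ _ e_re).
apply: filterS => n; rewrite /= mul1r normrX normrX normc_def -/r.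
rewrite ger0_norm ?sqrtr_ge0// => rn.
by rewrite -rmorphXn /= ltcE /= e_im eqxx.
Qed.

Lemma cvg_geometric_seriesC (z : R[i]) : `|z| < 1 ->
  series ((fun n => z ^+ n) : nat -> R[i]^o) @ \oo --> ((1 - z)^-1 : R[i]^o).
Proof.
move=> z1.
have z_neq1 : z != 1 by apply: contraTneq z1 => ->; rewrite normr1 ltxx.
have -> : series ((fun n => z ^+ n) : nat -> R[i]^o) =
    (fun n => (1 - z)^-1 - z ^+ n * (1 - z)^-1).
  have := geometric_seriesE 1 z_neq1; rewrite -exprn_geometric => ->.
  by apply/funext => n /=; rewrite mul1r mulrBl mul1r.
rewrite -[X in _ --> X]subr0; apply: cvgB; first exact: cvg_cst.
by rewrite -[X in _ --> X](mul0r (1 - z)^-1); apply: cvgMr_tmp; exact: cvg_exprC.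
Qed.

End Convergence.

Section RationalFunctions.
Context (R : realType).
Implicit Types f g : R[i] -> R[i].

Lemma eq_rational_on_unit_disc f g : (forall t, `|t| < 1 -> f t = g t) ->
  rational_on_unit_disc f -> rational_on_unit_disc g.
Proof.
by move=> fg [p [q pq]]; exists p, q => t t1; rewrite -fg//; exact: pq.
Qed.

Lemma rational_on_unit_discD f g :
  rational_on_unit_disc f -> rational_on_unit_disc g ->
  rational_on_unit_disc (fun t => f t + g t).
Proof.
move=> [p1 [q1 pq1]] [p2 [q2 pq2]]; exists (p1 * q2 + p2 * q1), (q1 * q2) => t t1.
have [q10 ->] := pq1 t t1; have [q20 ->] := pq2 t t1.
by rewrite hornerM mulf_neq0// hornerD !hornerM addf_div.
Qed.

Lemma rational_on_unit_discM f g :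
  rational_on_unit_disc f -> rational_on_unit_disc g ->
  rational_on_unit_disc (fun t => f t * g t).
Proof.
move=> [p1 [q1 pq1]] [p2 [q2 pq2]]; exists (p1 * p2), (q1 * q2) => t t1.
have [q10 ->] := pq1 t t1; have [q20 ->] := pq2 t t1.
by rewrite !hornerM mulf_neq0// mulf_div.
Qed.

Lemma rational_on_unit_disc_horner (p : {poly R[i]}) :
  rational_on_unit_disc (horner p).
Proof. by exists p, 1 => t _; rewrite hornerC oner_neq0 divr1. Qed.

Lemma rational_on_unit_discV (p : {poly R[i]}) :
  (forall t, `|t| < 1 -> p.[t] != 0) ->
  rational_on_unit_disc (fun t => p.[t]^-1).
Proof. by move=> p0; exists 1, p => t t1; rewrite hornerC div1r p0. Qed.

Lemma rational_on_unit_disc_sum (I : Type) (r : seq I) (P : pred I)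
    (F : I -> R[i] -> R[i]) :
  (forall i, P i -> rational_on_unit_disc (F i)) ->
  rational_on_unit_disc (fun t => \sum_(i <- r | P i) F i t).
Proof.
move=> rF; rewrite (_ : (fun _ => _) = \sum_(i <- r | P i) F i); last first.
  by apply/funext => t; rewrite fct_sumE.
elim/big_rec: _ => [|i f Pi rf].
  apply: eq_rational_on_unit_disc (rational_on_unit_disc_horner 0) => t _.
  by rewrite horner0.
exact: rational_on_unit_discD (rF i Pi) rf.
Qed.

End RationalFunctions.

Lemma prod_one_sub_exp (A : comPzRingType) (k : nat) (y : 'I_k -> nat) (t : A) :
  \prod_(j < k) (1 - t ^+ y j) =
  \sum_(J : {set 'I_k}) (-1) ^+ #|J| * t ^+ (\sum_(j in J) y j).
Proof.
under eq_bigr do rewrite addrC.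
rewrite bigA_distr; apply: eq_bigr => J _.
by rewrite -big_mkcond /= prodrN expr_sum.
Qed.

Section ProductSeriesLimit.
Context (R : realType) (k : nat) (x : 'I_k -> nat) (b : nat).
Hypotheses (k_gt0 : (0 < k)%N) (b_lt_x : forall j, (b < x j)%N).
Local Notation sub_sum J := (\sum_(j in J) x j)%N.

Lemma lt_sub_sum (J : {set 'I_k}) : J != finset.set0 -> (b < sub_sum J)%N.
Proof.
case/set0Pn => j jJ; apply: leq_trans (b_lt_x j) _.
by rewrite (bigD1 j) //= leq_addr.
Qed.

Definition rational_form (t : R[i]) : R[i] :=
  (\prod_(j < k) (1 - t ^+ x j))^-1 *
  \sum_(J : {set 'I_k} | J != finset.set0)
    (-1) ^+ #|J| * (t ^+ sub_sum J - 1) * (1 - t ^+ (sub_sum J - b))^-1.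

Lemma exprN_mul_exp (F : fieldType) (t : F) (m n : nat) : (b < n)%N ->
  t ^- (b * m) * t ^+ (m * n) = (t ^+ (n - b)) ^+ m.
Proof.
move=> bn; have [->|t0] := eqVneq t 0.
  case: m => [|m]; first by rewrite muln0 mul0n !expr0 invr1 mulr1.
  have n_gt0 : (0 < n)%N by exact: leq_ltn_trans bn.
  by rewrite [0 ^+ (_ * n)]expr0n muln_eq0 (gtn_eqF n_gt0) mulr0 expr0n
    subn_eq0 leqNgt bn expr0n.
rewrite -exprM mulnBl [(m * n)%N]mulnC; apply: (mulfI (expf_neq0 (b * m) t0)).
by rewrite mulVKf ?expf_neq0// -exprD subnKC// leq_mul2r ltnW ?orbT.
Qed.

Lemma product_term_subsets (t : R[i]) (m : nat) :
  product_term x b t m =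
  (\prod_(j < k) (1 - t ^+ x j))^-1 *
  \sum_(J : {set 'I_k} | J != finset.set0)
    (-1) ^+ #|J| * (t ^+ sub_sum J - 1) * (t ^+ (sub_sum J - b)) ^+ m.
Proof.
rewrite /product_term !prodf_div -mulrBl mulrA mulrC; congr (_ * _).
rewrite !prod_one_sub_exp -sumrB mulr_sumr (bigD1 finset.set0)//=.
rewrite !big_set0 subrr mulr0 add0r; apply: eq_bigr => J J0.
rewrite -!big_distrr /= -(exprN_mul_exp t m (lt_sub_sum J0)) mulSn exprD.
by rewrite -mulrBr -[X in _ - X]mul1r -mulrBl mulrCA -mulrA [X in _ * X]mulrCA.
Qed.

Lemma cvg_product_series (t : R[i]) : `|t| < 1 ->
  series (product_term x b t) @ \oo --> (rational_form t : R[i]^o).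
Proof.
move=> t1; rewrite (_ : series _ = fun N =>
  (\prod_(j < k) (1 - t ^+ x j))^-1 *
  \sum_(J : {set 'I_k} | J != finset.set0)
    (-1) ^+ #|J| * (t ^+ sub_sum J - 1) *
    series ((fun m => (t ^+ (sub_sum J - b)) ^+ m) : nat -> R[i]^o) N).
  apply: cvgMl_tmp; apply: (cvg_big (op := +%R)) => [|J J0].
    exact: add_continuous.
  apply: cvgMl_tmp; apply: cvg_geometric_seriesC.
  by rewrite normrX exprn_ilt1// -lt0n subn_gt0 lt_sub_sum.
apply/funext => N; rewrite /series /=.
under eq_bigr do rewrite product_term_subsets.
rewrite -mulr_sumr exchange_big /=; congr (_ * _).
by apply: eq_bigr => J _; rewrite mulr_sumr.
Qed.

Lemma rational_rational_form : rational_on_unit_disc rational_form.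
Proof.
have x_gt0 j : (0 < x j)%N by exact: leq_ltn_trans (b_lt_x j).
have rV n : (0 < n)%N -> rational_on_unit_disc (fun t : R[i] => (1 - t ^+ n)^-1).
  move=> n0; apply: (@eq_rational_on_unit_disc _
    (fun t => (1 - 'X^n : {poly R[i]}).[t]^-1)).
    by move=> t _; rewrite !hornerE.
  by apply: rational_on_unit_discV => t t1; rewrite !hornerE one_sub_exp_neq0.
apply: rational_on_unit_discM.
  apply: (@eq_rational_on_unit_disc _
    (fun t => (\prod_(j < k) (1 - 'X^(x j)) : {poly R[i]}).[t]^-1)) => [t _|].
    by rewrite horner_prod; congr _^-1; apply: eq_bigr => j _; rewrite !hornerE.
  apply: rational_on_unit_discV => t t1; rewrite horner_prod.
  by apply/prodf_neq0 => j _; rewrite !hornerE one_sub_exp_neq0.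
apply: rational_on_unit_disc_sum => J J0; apply: rational_on_unit_discM.
  apply: eq_rational_on_unit_disc
    (rational_on_unit_disc_horner ((-1) ^+ #|J| *: ('X^(sub_sum J) - 1))) => t _.
  by rewrite !hornerE.
by apply: rV; rewrite subn_gt0 lt_sub_sum.
Qed.

Lemma cvg_product_sub_gen (t : R[i]) : `|t| < 1 ->
  (series (gen_term x b t) - series (product_term x b t)) @ \oo --> (0 : R[i]^o).
Proof.
move=> t1; pose s := sqrtC `|t|.
have s0 : 0 <= s by rewrite sqrtC_ge0.
have ts : `|t| = s ^+ 2 by rewrite sqrtCK.
have s1 : s < 1 by rewrite -sqrtC1 ltr_sqrtC ?qualifE/= ?ler01.
have : ((fun N => s ^+ N * (1 - s)^-1 ^+ k) : nat -> R[i]^o) @ \oo --> (0 : R[i]^o).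
  rewrite -[X in _ --> X](mul0r ((1 - s)^-1 ^+ k)); apply: cvgMr_tmp.
  by apply: cvg_exprC; rewrite ger0_norm.
move=> /cvgr0Pnorm_lt h; apply/cvgr0Pnorm_lt => e /h.
apply: filterS => N; apply: le_lt_trans.
rewrite [leRHS]ger0_norm; last first.
  by rewrite mulr_ge0 ?exprn_ge0// invr_ge0 subr_ge0 ltW.
rewrite (_ : (_ - _) N =
    \sum_(l < N) gen_term x b t l - \sum_(m < N) product_term x b t m); last first.
  by rewrite -!(big_mkord xpredT).
rewrite -normrN opprB sum_product_sub_gen_term//.
exact: sum_large_excess_bound.
Qed.

Lemma cvg_gen_series (t : R[i]) : `|t| < 1 ->
  series (gen_term x b t) @ \oo --> (rational_form t : R[i]^o).
Proof.
by move=> t1; apply: cvg_sub0 (cvg_product_sub_gen t1) (cvg_product_series t1).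
Qed.

End ProductSeriesLimit.

Section FiniteSolutionSets.
Context (k : nat) (x : 'I_k -> nat) (b : nat).

Lemma infinite_solutions0 (a : {ffun 'I_k -> nat}) (j : 'I_k) :
  (0 < a j)%N -> (\sum_(i < k) x i * a i = b * \max_(i < k) a i)%N ->
  ~ finite_set (solutions x b 0).
Proof.
move=> aj_gt0 sol_a fin; apply: infinite_nat.
pose ray n : {ffun 'I_k -> nat} := [ffun i => n * a i]%N.
have -> : [set: nat] = ray @^-1` solutions x b 0.
  apply/seteqP; split=> // n _; rewrite /solutions /=.
  rewrite (_ : (\sum_(i < k) _ = n * \sum_(i < k) x i * a i)%N); last first.
    by rewrite big_distrr; apply: eq_bigr => i _; rewrite ffunE mulnCA.
  rewrite (_ : (\max_(i < k) _ = n * \max_(i < k) a i)%N); last first.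
    rewrite (big_morph (muln n) (id1 := 0%N) (op1 := maxn)) ?muln0//;
      last exact: maxnMr.
    by apply: eq_bigr => i _; rewrite ffunE.
  by rewrite sol_a mulnCA subrr.
apply: finite_preimage => // m n _ _ /ffunP /(_ j); rewrite !ffunE => /eqP.
by rewrite eqn_pmul2r// => /eqP.
Qed.

Lemma finite_solutions0_dichotomy :
  finite_set (solutions x b 0) ->
  (forall j, (b < x j)%N) \/ (\sum_(j < k) x j < b)%N.
Proof.
move=> fin; have [/forallP|] := boolP [forall j, b < x j]%N; first by left.
case/forallPn => j; rewrite -leqNgt => xj_le_b; right.
rewrite ltnNge; apply/negP => b_le_sum; move: fin.
move: b_le_sum; rewrite (bigD1 j)//=.
set S := (\sum_(i < k | i != j) x i)%N => b_le_sum.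
have [xj_eq_b|xj_neq_b] := eqVneq (x j) b.
  apply: (@infinite_solutions0 [ffun i => (i == j) : nat] j).
    by rewrite ffunE eqxx.
  rewrite (bigD1 j)//= ffunE eqxx big1 ?addn0; last first.
    by move=> i /negPf ij; rewrite ffunE ij muln0.
  rewrite xj_eq_b; congr (_ * _)%N; apply/eqP; rewrite eqn_leq; apply/andP; split.
    by have := @leq_bigmax _ (fun i => [ffun i => (i == j) : nat] i) j;
      rewrite ffunE eqxx.
  by apply/bigmax_leqP => i _; rewrite ffunE leq_b1.
have xj_lt_b : (x j < b)%N by rewrite ltn_neqAle xj_neq_b.
have le_S : (b - x j <= S)%N by rewrite leq_subLR.
apply: (@infinite_solutions0 [ffun i => if i == j then S else b - x j]%N j).
  by rewrite ffunE eqxx (leq_trans _ le_S)// subn_gt0.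
rewrite (bigD1 j)//= ffunE eqxx.
rewrite (eq_bigr (fun i => x i * (b - x j)))%N; last first.
  by move=> i /negPf ij; rewrite ffunE ij.
rewrite -big_distrl /= -/S [(S * _)%N]mulnC -mulnDl subnKC//; congr (_ * _)%N.
apply/eqP; rewrite eqn_leq; apply/andP; split.
  by have := @leq_bigmax _ (fun i => [ffun i => if i == j then S else b - x j]%N i) j;
      rewrite ffunE eqxx.
by apply/bigmax_leqP => i _; rewrite ffunE; case: ifP.
Qed.

Lemma num_solutions_small_sum (l : nat) : (\sum_(j < k) x j < b)%N ->
  num_solutions x b l = (l == 0)%N.
Proof.
move=> sum_lt; have sol0 (a : {ffun 'I_k -> nat}) : solutions x b l a ->
    a = [ffun=> 0%N] /\ l = 0%N.
  rewrite /solutions /=; set M := (\max_(j < k) a j)%N => sol_a.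
  have aM j : (a j <= M)%N := leq_bigmax j.
  have le1 : (\sum_(j < k) x j * a j <= (\sum_(j < k) x j) * M)%N.
    by rewrite big_distrl; apply: leq_sum => j _; rewrite leq_mul2l aM orbT.
  have eq1 : (\sum_(j < k) x j * a j = l + b * M)%N.
    by apply/eqP; rewrite -eqz_nat PoszD -subr_eq sol_a.
  have M0 : M = 0%N.
    apply/eqP; rewrite -leqn0 leqNgt; apply/negP => M_gt0.
    have : ((\sum_(j < k) x j) * M < b * M)%N by rewrite ltn_pmul2r.
    by rewrite ltnNge (leq_trans (leq_addl l _))// -eq1.
  split; last by move: le1; rewrite eq1 M0 !muln0 addn0 leqn0 => /eqP.
  by apply/ffunP => j; rewrite ffunE; apply/eqP; rewrite -leqn0 -M0.
rewrite /num_solutions; have [l0|l_neq0] := eqVneq l 0%N.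
  rewrite (_ : solutions _ _ _ = [set [ffun=> 0%N]]) ?fset_set1 ?cardfs1//.
  apply/seteqP; split=> a; first by move=> /sol0[].
  by rewrite /solutions /= => ->; rewrite !big1 ?muln0 ?l0// => j _; rewrite ffunE ?muln0.
rewrite (_ : solutions _ _ _ = set0) ?fset_set0 ?cardfs0//.
by apply/seteqP; split=> a // /sol0[_ /eqP]; rewrite (negPf l_neq0).
Qed.

Lemma gen_fun_small_sum (R : realType) (t : R[i]) : (\sum_(j < k) x j < b)%N ->
  gen_fun x b t = 1.
Proof.
move=> sum_lt; apply: cvg_lim; first exact: norm_hausdorff.
rewrite (_ : series _ = fun n => (n != 0)%N%:R); last first.
  apply/funext => -[|n]; rewrite /series /=; first by rewrite big_geq.
  rewrite big_nat_recl// big1 => [|i _].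
    by rewrite /gen_term num_solutions_small_sum// expr0 mulr1 addr0.
  by rewrite /gen_term num_solutions_small_sum// mul0r.
by apply: cvg_near_cst; exists 1%N => // -[].
Qed.

End FiniteSolutionSets.

Theorem theoremA1 (R : realType) (k : nat) (x : 'I_k -> nat) (b : nat)
    (k_gt0 : (0 < k)%N) (x_gt0 : forall j, (0 < x j)%N) (b_gt0 : (0 < b)%N) :
  ((forall j, (b < x j)%N) ->
     (forall l : nat, finite_set (solutions x b l)) /\
     (forall t : R[i], `|t| < 1 ->
        [/\ cvgn (series (gen_term x b t)),
            cvgn (series (product_term x b t)) &
            gen_fun x b t = limn (series (product_term x b t))])) /\
  ((forall l : nat, finite_set (solutions x b l)) ->
     rational_on_unit_disc (@gen_fun R k x b)).
Proof.
have gen_funE t : (forall j, (b < x j)%N) -> `|t| < 1 ->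
    gen_fun x b t = rational_form x b t :> R[i].
  move=> b_lt_x t1; apply: (@cvg_lim R[i]^o); first exact: norm_hausdorff.
  exact: cvg_gen_series.
split=> [b_lt_x|/(_ 0%N)/finite_solutions0_dichotomy[b_lt_x|sum_lt_b]].
- split=> [l|t t1]; first exact: finite_solutions.
  have cvg_prod := cvg_product_series b_lt_x t1.
  split; first by apply/cvg_ex; eexists; exact: cvg_gen_series.
    by apply/cvg_ex; eexists; exact: cvg_prod.
  by rewrite gen_funE//; apply/esym/(@cvg_lim R[i]^o) => //; exact: norm_hausdorff.
- apply: eq_rational_on_unit_disc (rational_rational_form R b_lt_x) => t t1.
  by rewrite gen_funE.
- apply: eq_rational_on_unit_disc (rational_on_unit_disc_horner 1) => t _.
  by rewrite gen_fun_small_sum// hornerC.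
Qed.
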